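(* For $r,s\in\mathbb N$ such that $s\leq r\neq0$, let $1\leq\lambda_1<\cdots<\lambda_s\leq r$ and let $a_1,\dots,a_{r+1},b_1,\dots,b_s$ be positive real numbers. Let $(\alpha_{k+r})_{k\in\mathbb N}$ be defined by $$\alpha_{k+r}=\frac{\prod_{i=1,\,i\neq[k]_{r+1}}^{r+1}a_i^{(k)}}{\prod_{j=1}^{s}b_j^{(k)}}\quad\text{if }[k]_r\notin\{\lambda_1,\dots,\lambda_s\},$$ $$\alpha_{k+r}=\frac{\left(b_\ell^{(k)}-a_{[k]_{r+1}}^{(k)}\right)\prod_{i=1,\,i\neq[k]_{r+1}}^{r+1}a_i^{(k)}}{\left(b_\ell^{(k)}-1\right)\prod_{j=1}^{s}b_j^{(k)}}\quad\text{if }[k]_r=\lambda_\ell\text{ with }1\leq\ell\leq s.$$ Then the coefficients $\alpha_{k+r}$, $k\in\mathbb N$, are all nonnegative if and only if $$b_j\geq a_i-\left\lceil\frac{i-\lambda_j}{r}\right\rceil=\begin{cases}a_i&\text{if }i\leq\lambda_j\\ a_i-1&\text{if }i\geq\lambda_j+1\end{cases}\qquad\text{for all }1\leq i\leq r+1\text{ and }1\leq j\leq s,$$ and $$\frac{b_s-a_{r+1}}{b_s-1}\geq0\qquad\text{when }\lambda_s=r.$$ Furthermore, the coefficients $\alpha_{k+r}$, $k\in\mathbb N$, are all positive if and only if all the inequalities above are strict.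
   Context: $\mathbb N=\{0,1,2,\dots\}$. For integers $k$ and $n\ge1$, $[k]_n$ denotes the unique element of $\{1,\dots,n\}$ congruent to $k$ modulo $n$. For $k\in\mathbb N$, $1\le i\le r+1$, $1\le j\le s$: $$a_i^{(k)}=a_i+\left\lceil\frac{k+1-i}{r+1}\right\rceil,\qquad b_j^{(k)}=b_j+\left\lceil\frac{k+1-\lambda_j}{r}\right\rceil.$$ It is understood that the coefficients are well defined, i.e. that $b_s\neq1$ when $\lambda_s=r$ (otherwise $\alpha_r$ has a vanishing denominator). *)

(* Defs.v *)
From mathcomp Require Import all_boot all_order all_algebra reals.

Set Implicit Arguments.
Unset Strict Implicit.
Unset Printing Implicit Defensive.

Import Order.TTheory GRing.Theory Num.Theory.
Local Open Scope ring_scope.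

(* Families a_1, ..., a_(r+1), b_1, ..., b_s and lambda_1, ..., lambda_s are
   functions on nat, read only at the indices 1..r+1, resp. 1..s. *)

(* The representative [k]_n of k modulo n in {1, ..., n} (not {0, ..., n-1}). *)
Definition residue (n k : nat) : nat :=
  if (n %| k)%N then n else (k %% n)%N.

Lemma residueP (n k m : nat) : (0 < n)%N ->
  residue n k = m <-> (1 <= m <= n)%N /\ (m = k %[mod n])%N.
Proof.
move=> n0; rewrite /residue; split=> [<-|[/andP[m1 mn] E]].
  case: ifP => [|/negbT nk]; first by rewrite /dvdn n0 leqnn modnn => /eqP ->.
  by rewrite modn_mod lt0n nk ltnW ?ltn_mod.
rewrite /dvdn -E; case: (ltngtP m n) mn => // [mn|->] _.
  by rewrite modn_small // gtn_eqF.
by rewrite modnn.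
Qed.

Definition a_shift (R : realType) (r : nat) (a : nat -> R) (k i : nat) : R :=
  a i + (Num.ceil ((k%:R + 1 - i%:R) / r.+1%:R : R))%:~R.

Definition b_shift (R : realType) (r : nat) (lambda : nat -> nat)
    (b : nat -> R) (k j : nat) : R :=
  b j + (Num.ceil ((k%:R + 1 - (lambda j)%:R) / r%:R : R))%:~R.

(* Main.v *)
Require Import Defs.
From mathcomp Require Import all_boot all_order all_algebra reals.
From mathcomp Require Import zify ring lra.

Set Implicit Arguments.
Unset Strict Implicit.
Unset Printing Implicit Defensive.

Import Order.TTheory GRing.Theory Num.Theory.
Local Open Scope ring_scope.

(* Write k = lambda_l + r (M - 1) = i + (r+1) (N - 1) with i = [k]_(r+1).  Then
   b_l^(k) = b_l + M and a_i^(k) = a_i + N, and every factor of alpha_(k+r) other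
   than (b_l + M - a_i - N) / (b_l + M - 1) is positive.  For k = 0 we have
   M = N = 0, i = r+1 and lambda_l = r, which is the exceptional condition.  For
   k > 0 we have M, N >= 1, so the denominator is positive, and
   r (M - N) = i - lambda_l + N - 1 forces M - N >= [lambda_l < i]; equality is
   attained at k = i + (r+1) (lambda_l - i) if i <= lambda_l, and at
   k = i + (r+1) (r + lambda_l - i) otherwise. *)

Lemma ceil_ratio (R : realType) (n : nat) (p c : int) : (0 < n)%N ->
  n%:Z * (c - 1) < p -> p <= n%:Z * c -> Num.ceil (p%:~R / n%:R : R) = c.
Proof.
move=> n0 lt_p le_p; apply: ceil_def; apply/andP; split.
  by rewrite ltr_pdivlMr ?ltr0n// -[n%:R]/(n%:Z%:~R) -intrM ltr_int mulrC.
by rewrite ler_pdivrMr ?ltr0n// -[n%:R]/(n%:Z%:~R) -intrM ler_int mulrC.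
Qed.

(** The hypothesis says that [k + 1 - i] equals [n * (q - 1) + 1], which lies in the interval from
    [n * (q - 1)], excluded, to [n * q]; adding [n] to [k] keeps it in [nat] and admits [q = 0]. *)
Lemma ceil_shift (R : realType) (n k i q : nat) : (0 < n)%N ->
  (k + n = i + n * q)%N ->
  Num.ceil ((k%:R + 1 - i%:R) / n%:R : R) = q%:Z.
Proof.
move=> n0 E.
have -> : k%:R + 1 - i%:R = (k%:Z + 1 - i%:Z)%:~R :> R.
  by rewrite intrB intrD.
by apply: ceil_ratio => //; nia.
Qed.

(** Since [i <= n], the quotient exceeds -1. Hence shifting keeps the positive parameters
    positive. *)
Lemma ceil_shift_ge0 (R : realType) (n k i : nat) : (0 < n)%N -> (i <= n)%N ->
  0 <= (Num.ceil ((k%:R + 1 - i%:R) / n%:R : R))%:~R :> R.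
Proof.
move=> n0 ile; rewrite ler0z ceil_ge0 ltr_pdivlMr ?ltr0n// mulN1r.
have : i%:R <= n%:R :> R by rewrite ler_nat.
have : 0 <= k%:R :> R by rewrite ler0n.
lra.
Qed.

Lemma residue_bounds (n k : nat) : (0 < n)%N -> (1 <= residue n k <= n)%N.
Proof. by move=> n0; case: (proj1 (@residueP n k _ n0) erefl). Qed.

Lemma residue_div (n k : nat) : (0 < n)%N ->
  exists q, (k + n = residue n k + n * q)%N.
Proof.
move=> n0; rewrite /residue; case: ifP => [/dvdnP[q ->]|_].
  by exists q; lia.
by exists (k %/ n).+1; have := divn_eq k n; lia.
Qed.

Lemma residue_eq (n k i q : nat) : (1 <= i <= n)%N -> (k + n = i + n * q)%N ->
  residue n k = i.
Proof.
move=> ib E; apply/residueP; first by lia.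
by split=> //; rewrite -(modnDr k n) E addnC mulnC modnMDl.
Qed.

Lemma ceil_index (R : realType) (r i l : nat) : (1 <= i <= r.+1)%N ->
  (1 <= l <= r)%N ->
  Num.ceil ((i%:R - l%:R) / r%:R : R) = (l < i)%N%:Z.
Proof.
move=> ib lb.
have -> : i%:R - l%:R = (i%:Z - l%:Z)%:~R :> R by rewrite intrB.
by apply: ceil_ratio; case: ltnP => ?; lia.
Qed.

(** Both sides of the equation are [k + r + 1]. If [l < i], then [r * (M - N)] is positive;
    otherwise it is at least [i - l], which exceeds [-r]. *)
Lemma shift_gap (r l i M N : nat) : (l <= r)%N -> (0 < i)%N -> (0 < N)%N ->
  ((l + r * M).+1 = i + r.+1 * N)%N -> (N + (l < i) <= M)%N.
Proof. by move=> lr i0 N0 E; case: ltnP => li /=; nia. Qed.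

(** Setting [M - N] to 0 or 1 in [r * (M - N) = i - l + N - 1] and solving for [N] gives the
    witnesses. *)
Lemma shift_gap_attained (r l i : nat) : (1 <= i <= r.+1)%N -> (1 <= l <= r)%N ->
  exists k N, [/\ (0 < N)%N, (k + r = l + r * (N + (l < i)))%N
    & (k + r.+1 = i + r.+1 * N)%N].
Proof.
move=> ib lb; case: ltnP => li /=.
  exists (i + r.+1 * (r + l - i))%N, (r + l - i).+1; split; nia.
exists (i + r.+1 * (l - i))%N, (l - i).+1; split; nia.
Qed.

Theorem proposition5p6 (R : realType) (r s : nat)
  (lambda : nat -> nat) (a b alpha : nat -> R)
  (hsr : (s <= r)%N) (hr : r <> 0%N)
  (hlambda_range : forall j, (1 <= j <= s)%N -> (1 <= lambda j <= r)%N)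
  (hlambda_incr : forall j j', (1 <= j)%N -> (j < j')%N -> (j' <= s)%N ->
    (lambda j < lambda j')%N)
  (ha : forall i, (1 <= i <= r.+1)%N -> 0 < a i)
  (hb : forall j, (1 <= j <= s)%N -> 0 < b j)
  (hwell_defined : (1 <= s)%N -> lambda s = r -> b s <> 1)
  (halpha_out : forall k : nat,
    (forall l, (1 <= l <= s)%N -> residue r k <> lambda l) ->
    alpha (k + r)%N =
      (\prod_(1 <= i < r.+2 | i != residue r.+1 k) a_shift r a k i)
      / (\prod_(1 <= j < s.+1) b_shift r lambda b k j))
  (halpha_in : forall k l : nat, (1 <= l <= s)%N -> residue r k = lambda l ->
    alpha (k + r)%N =
      ((b_shift r lambda b k l - a_shift r a k (residue r.+1 k))
        * \prod_(1 <= i < r.+2 | i != residue r.+1 k) a_shift r a k i)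
      / ((b_shift r lambda b k l - 1)
        * \prod_(1 <= j < s.+1) b_shift r lambda b k j)) :
  [/\ (forall i j, (1 <= i <= r.+1)%N -> (1 <= j <= s)%N ->
        a i - (Num.ceil ((i%:R - (lambda j)%:R) / r%:R : R))%:~R
        = if (i <= lambda j)%N then a i else a i - 1),
      (forall k : nat, 0 <= alpha (k + r)%N) <->
      ((forall i j, (1 <= i <= r.+1)%N -> (1 <= j <= s)%N ->
          b j >= a i - (Num.ceil ((i%:R - (lambda j)%:R) / r%:R : R))%:~R)
       /\ ((1 <= s)%N -> lambda s = r ->
            (b s - a r.+1) / (b s - 1) >= 0))
    & (forall k : nat, 0 < alpha (k + r)%N) <->
      ((forall i j, (1 <= i <= r.+1)%N -> (1 <= j <= s)%N ->
          b j > a i - (Num.ceil ((i%:R - (lambda j)%:R) / r%:R : R))%:~R)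
       /\ ((1 <= s)%N -> lambda s = r ->
            (b s - a r.+1) / (b s - 1) > 0))].
Proof.
have r0 : (0 < r)%N by lia.
pose A k := \prod_(1 <= i < r.+2 | i != residue r.+1 k) a_shift r a k i.
pose B k := \prod_(1 <= j < s.+1) b_shift r lambda b k j.
have A_gt0 k : 0 < A k.
  rewrite /A big_nat_cond prodr_gt0// => i /andP[/andP[i1 ir] _].
  by rewrite ltr_pwDl ?ha ?i1// ceil_shift_ge0.
have B_gt0 k : 0 < B k.
  rewrite /B big_nat_cond prodr_gt0// => j /andP[/andP[j1 js] _].
  have jb : (1 <= j <= s)%N by rewrite j1.
  by rewrite ltr_pwDl ?hb// ceil_shift_ge0//; case/andP: (hlambda_range _ jb).
(* The flag [C] selects [<=] (true) or [<] (false), so both equivalences are proved at once. The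
   positive factor [A k / B k] is split off. *)
have alphaE C k l i M N : (1 <= l <= s)%N -> (1 <= i <= r.+1)%N ->
    (k + r = lambda l + r * M)%N -> (k + r.+1 = i + r.+1 * N)%N ->
    (0 < alpha (k + r)%N ?<= if C) =
    (0 < (b l + M%:R - (a i + N%:R)) / (b l + M%:R - 1) ?<= if C).
  move=> lb ib EM EN.
  rewrite (@halpha_in k l)//; last first.
    by apply: residue_eq EM; exact: hlambda_range.
  rewrite (residue_eq ib EN) /b_shift /a_shift (ceil_shift R r0 EM).
  rewrite (ceil_shift R (ltn0Sn r) EN) -/(B k).
  rewrite -(residue_eq ib EN) -/(A k) -mulf_div.
  by rewrite -[X in X < _ ?<= if _](mul0r (A k / B k)) lteif_pM2r// divr_gt0.
have alpha_late C k l i M N : (1 <= l <= s)%N -> (1 <= i <= r.+1)%N ->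
    (0 < M)%N -> (k + r = lambda l + r * M)%N -> (k + r.+1 = i + r.+1 * N)%N ->
    (0 < alpha (k + r)%N ?<= if C) =
    (0 < b l + M%:R - (a i + N%:R) ?<= if C).
  move=> lb ib M0 EM EN; rewrite (alphaE C k l i M N)//.
  rewrite lteif_pdivlMr ?mul0r// subr_gt0 ltr_pwDl ?hb//.
  by rewrite ler1n.
have sign C : (forall k : nat, 0 < alpha (k + r)%N ?<= if C) <->
    (forall i j, (1 <= i <= r.+1)%N -> (1 <= j <= s)%N ->
       a i - (lambda j < i)%N%:R < b j ?<= if C) /\
    ((1 <= s)%N -> lambda s = r -> 0 < (b s - a r.+1) / (b s - 1) ?<= if C).
  split=> [pos|[gap exc] k].
    split=> [i j ib jb|s1 ls].
      (* At this [k] the numerator is exactly [b j - (a i - [lambda j < i])]. *)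
      have [k [N [N0 EM EN]]] := shift_gap_attained ib (hlambda_range _ jb).
      have := pos k; rewrite (alpha_late C k j i _ _ jb ib _ EM EN); last by lia.
      rewrite -[a i - _ < _ ?<= if _]subr_lteif0r natrD.
      by rewrite (_ : b j + _ - _ = b j - (a i - (lambda j < i)%N%:R)) //; ring.
    have := pos 0%N.
    by rewrite (alphaE C 0%N s r.+1 0%N 0%N) ?addr0 ?s1 ?leqnn ?ls ?muln0 ?addn0.
  case: (boolP [exists l : 'I_s.+1, (1 <= l)%N && (residue r k == lambda l)]).
    case/existsP=> l /andP[l1 /eqP rl].
    have lb : (1 <= l <= s)%N by rewrite l1 -ltnS ltn_ord.
    have [/andP[l_gt0 l_le]] := hlambda_range _ lb.
    have ib := residue_bounds k (ltn0Sn r).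
    have [M EM] := residue_div k r0; rewrite rl in EM.
    have [N EN] := residue_div k (ltn0Sn r).
    have [k0|k_gt0] := posnP k.
      have [lr M0] : lambda l = r /\ M = 0%N by case: (M) EM => [|m] /=; nia.
      have [ir N0] : residue r.+1 k = r.+1 /\ N = 0%N.
        by case: (N) EN => [|n] /=; nia.
      (* As [lambda] increases strictly and is bounded by [r], only its last value can equal [r]. *)
      have ls : l = s :> nat.
        apply/eqP; move: lb; rewrite andbC leq_eqVlt => /andP[/orP[//|lts] _].
        have := hlambda_incr _ _ l1 lts (leqnn s).
        have /andP[_] : (1 <= lambda s <= r)%N by apply: hlambda_range; lia.
        by lia.
      rewrite ls in EM rl lb lr.
      rewrite (alphaE C k s _ M N lb ib EM EN) M0 N0 ir !addr0.
      by apply: exc => //; lia.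
    have M0 : (0 < M)%N by case: (M) EM => [|m] //=; nia.
    have N0 : (0 < N)%N by case: (N) EN => [|n] //=; nia.
    rewrite (alpha_late C k l _ M N lb ib M0 EM EN).
    set i := residue r.+1 k in ib EN *.
    have : (N + (lambda l < i) <= M)%N by apply: (@shift_gap r) => //; lia.
    rewrite -(ler_nat R) natrD => NM.
    (* The numerator is at least [b l - (a i - [lambda l < i])]; chaining with this weak inequality
       preserves the flag [C]. *)
    have := gap i l ib lb; rewrite -subr_lteif0r => /lteif_trans.
    move/(_ (b l + M%:R - (a i + N%:R)) true).
    rewrite andbT; apply=> /=; lra.
  (* Here the coefficient is [A k / B k], positive without any condition. *)
  rewrite negb_exists => /forallP nol; rewrite halpha_out.
    by apply: lteifS; rewrite divr_gt0 ?A_gt0 ?B_gt0.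
  move=> l /andP[l1 ls] rl; have := nol (Ordinal (ls : (l < s.+1)%N)).
  by rewrite /= l1 rl eqxx.
have sign_ceil C : (forall k : nat, 0 < alpha (k + r)%N ?<= if C) <->
    (forall i j, (1 <= i <= r.+1)%N -> (1 <= j <= s)%N ->
       a i - (Num.ceil ((i%:R - (lambda j)%:R) / r%:R : R))%:~R < b j ?<= if C)
    /\ ((1 <= s)%N -> lambda s = r -> 0 < (b s - a r.+1) / (b s - 1) ?<= if C).
  rewrite sign; split=> -[gap exc]; split=> // i j ib jb.
    by rewrite ceil_index ?gap// hlambda_range.
  by have := gap i j ib jb; rewrite ceil_index// hlambda_range.
split.
- move=> i j ib jb; rewrite ceil_index ?hlambda_range//.
  by case: ltnP => _; rewrite ?subr0.
- exact: (sign_ceil true).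
- exact: (sign_ceil false).
Qed.
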